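(* Let $X$ be a locally compact Hausdorff space, let $w : X \to \mathbb{K}$ be a bounded continuous map, and let $f : X \to X$ be a continuous map such that $f^{-1}(K) \cap \{x \in X : |w(x)| \geq \varepsilon\}$ is compact for every $\varepsilon > 0$ and every compact $K \subset X$ (so that $C_{w,f}(\varphi) := (\varphi \circ f)\cdot w$ is a well-defined bounded linear operator on $C_0(X)$). Then the weighted composition operator $C_{w,f}$ on $C_0(X)$ is Li-Yorke chaotic if and only if there is a sequence $(B_i)_{i \in \mathbb{N}}$ of relatively compact open subsets of $X$ such that the following conditions hold: (A) There is an increasing sequence $(n_j)_{j \in \mathbb{N}}$ of positive integers such that $\lim_{j \to \infty} \|w^{(n_j)}\|_{f^{-n_j}(B_i)} = 0$ for all $i \in \mathbb{N}$. (B) $\sup\big\{\|w^{(n)}\|_{f^{-n}(B_i)} : i,n \in \mathbb{N}\big\} = \infty$.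
   Context: $\mathbb{K}$ denotes $\mathbb{R}$ or $\mathbb{C}$, and $\mathbb{N} = \{1,2,3,\ldots\}$. $C_0(X)$ is the Banach space over $\mathbb{K}$ of all continuous maps $\varphi : X \to \mathbb{K}$ vanishing at infinity, with norm $\|\varphi\| = \sup_{x \in X}|\varphi(x)|$. For $B \subset X$ and $\varphi : X \to \mathbb{K}$, $\|\varphi\|_B := \sup_{x \in B}|\varphi(x)|$, with the convention that this is $0$ if $B = \varnothing$. The maps $w^{(n)} : X \to \mathbb{K}$ are defined by $w^{(1)} := w$ and $w^{(n)} := (w \circ f^{n-1})\cdots(w \circ f)\cdot w$ for $n \geq 2$. $f^{-n}(B)$ is the preimage of $B$ under the $n$-th iterate $f^n$. ''Increasing sequence of positive integers'' means strictly increasing. A continuous map $g : M \to M$ on a metric space $(M,d)$ is Li-Yorke chaotic if there is an uncountable set $S \subset M$ such that for all distinct $x,y \in S$, $\liminf_{n \to \infty} d(g^n(x),g^n(y)) = 0$ and $\limsup_{n\to\infty} d(g^n(x),g^n(y)) > 0$. *)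

(* Defs.v *)
From HB Require Import structures.
From mathcomp Require Import all_boot all_order all_algebra.
From mathcomp Require Import all_classical all_reals all_analysis.
From mathcomp Require Import complex.

Set Implicit Arguments.
Unset Strict Implicit.
Unset Printing Implicit Defensive.

Import Order.TTheory GRing.Theory Num.Theory.
Import numFieldNormedType.Exports.

Local Open Scope classical_set_scope.
Local Open Scope ring_scope.

Inductive scalar_kind := RealScalars | ComplexScalars.

Definition scalars (R : realType) (k : scalar_kind) : numFieldType :=
  match k with
  | RealScalars => R
  | ComplexScalars => R[i]
  end.

(* The library norm `|x| of x : scalars R k is valued in scalars R k itself;
   for complex scalars its imaginary part is zero. *)
Definition modulus (R : realType) (k : scalar_kind) : scalars R k -> R :=
  match k with
  | RealScalars => fun x : R => `|x|
  | ComplexScalars => fun x : R[i] => complex.Re `|x|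
  end.

Arguments modulus {R k} x.

Section ModulusTheory.
Context {R : realType} {k : scalar_kind}.
Implicit Types x y : scalars R k.

Definition of_real : R -> scalars R k :=
  match k with
  | RealScalars => fun r : R => r
  | ComplexScalars => fun r : R => complex.Complex r 0
  end.

Lemma norm_modulus x : `|x| = of_real (modulus x).
Proof. by rewrite /of_real /modulus; case: k x => // -[a b]. Qed.

Lemma of_real_lt r s : (of_real r < of_real s) = (r < s).
Proof. by rewrite /of_real; case: k => //; rewrite ltcR. Qed.

Lemma of_real_le r s : (of_real r <= of_real s) = (r <= s).
Proof. by rewrite /of_real; case: k => //; rewrite lecR. Qed.

Lemma of_real0 : of_real 0 = 0.
Proof. by rewrite /of_real; case: k. Qed.

Lemma of_realD r s : of_real (r + s) = of_real r + of_real s.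
Proof.
rewrite /of_real; case: k => //.
by apply/eqP; rewrite eq_complex/= addr0 !eqxx.
Qed.

Lemma of_realM r s : of_real (r * s) = of_real r * of_real s.
Proof.
rewrite /of_real; case: k => //.
by apply/eqP; rewrite eq_complex/= !mulr0 !mul0r subr0 addr0 !eqxx.
Qed.

Lemma of_real_inj : injective of_real.
Proof. by move=> r s e; apply/eqP; rewrite eq_le -!of_real_le e !lexx. Qed.

Lemma modulus_ge0 x : 0 <= modulus x.
Proof. by rewrite -of_real_le of_real0 -norm_modulus. Qed.

Lemma modulus0 : modulus (0 : scalars R k) = 0.
Proof. by apply: of_real_inj; rewrite -norm_modulus normr0 of_real0. Qed.

Lemma modulus0_eq0 x : modulus x = 0 -> x = 0.
Proof.
by move=> x0; apply/eqP; rewrite -normr_eq0 norm_modulus x0 of_real0.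
Qed.

Lemma modulusN x : modulus (- x) = modulus x.
Proof. by apply: of_real_inj; rewrite -!norm_modulus normrN. Qed.

Lemma modulusM x y : modulus (x * y) = modulus x * modulus y.
Proof. by apply: of_real_inj; rewrite of_realM -!norm_modulus normrM. Qed.

Lemma ler_modulusD x y : modulus (x + y) <= modulus x + modulus y.
Proof. by rewrite -of_real_le of_realD -!norm_modulus ler_normD. Qed.

Lemma modulusB x y : modulus (x - y) = modulus (y - x).
Proof. by rewrite -modulusN opprB. Qed.

Lemma modulus_continuous : continuous (@modulus R k).
Proof.
move=> x; have FF : Filter (nbhs x) by exact: nbhs_filter.
apply: (@cvgrPdist_lt _ R^o _ (nbhs x) FF _ _).2 => e e0.
have E0 : 0 < of_real e by rewrite -of_real0 of_real_lt.
apply: (@filterS _ (nbhs x) _ (ball x (of_real e)));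
  last exact: (nbhsx_ballx x _ E0).
move=> y; rewrite -ball_normE /=.
rewrite norm_modulus of_real_lt; apply: le_lt_trans.
have := ler_modulusD (y - x) x; have := ler_modulusD (x - y) y.
by rewrite !subrK (modulusB y x) ler_norml lerBlDr lerNl opprB lerBlDr => -> ->.
Qed.

End ModulusTheory.

Section C0.
Context {R : realType} {k : scalar_kind} {X : topologicalType}.
Notation K := (scalars R k).

(* Adjoining 0 does not change the supremum over a nonempty B, and makes the
   supremum over the empty set 0 instead of -oo. *)
Definition supnorm (B : set X) (phi : X -> K) : \bar R :=
  ereal_sup ([set 0%E] `|` [set (modulus (phi x))%:E | x in B]).

Definition vanishes_at_infinity (phi : X -> K) : Prop :=
  forall e : R, 0 < e ->
    exists2 C : set X, compact C & forall x, ~ C x -> modulus (phi x) < e.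

Definition C0_pred : {pred X -> K} :=
  [pred phi : X -> K | `[< continuous phi /\ vanishes_at_infinity phi >]].

Lemma C0_predP phi :
  reflect (continuous phi /\ vanishes_at_infinity phi) (phi \in C0_pred).
Proof. exact: asboolP. Qed.

Lemma C0_bounded phi : continuous phi -> vanishes_at_infinity phi ->
  exists2 M : R, 0 < M & forall x, modulus (phi x) <= M.
Proof.
move=> cphi /(_ 1 ltr01)[C cC C1].
have cmphi : compact ((modulus \o phi) @` C).
  apply: continuous_compact => //; apply: continuous_subspaceT => x.
  by apply: continuous_comp; [exact: cphi|exact: modulus_continuous].
have [z [_ zP]] : bounded_set ((modulus \o phi) @` C).
  exact: compact_bounded cmphi.
exists (Num.max 1 (z + 1)); first by rewrite lt_max ltr01.
move=> x; rewrite le_max; have [Cx|nCx] := pselect (C x); last first.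
  by rewrite (ltW (C1 _ nCx)).
apply/orP; right; rewrite -[leLHS]ger0_norm ?modulus_ge0//.
by apply: (zP (z + 1)); [rewrite ltrDl|exists x].
Qed.

Lemma C0_submod_closed : submod_closed C0_pred.
Proof.
split.
  apply/C0_predP; split; first by move=> x; exact: cvg_cst.
  by move=> e e0; exists set0 => [|x _]; [exact: compact0|rewrite modulus0].
move=> a phi psi /C0_predP[cphi vphi] /C0_predP[cpsi vpsi]; apply/C0_predP.
split.
  move=> x; apply: (@continuousD K K X); last exact: cpsi.
  by apply: (@continuousM K X) => //; [exact: cvg_cst|exact: cphi].
move=> e e0.
have a0 : 0 < modulus a + 1 by rewrite ltr_wpDl// modulus_ge0.
have e20 : 0 < e / 2 by rewrite divr_gt0.
have [C cC Ce] := vphi _ (divr_gt0 e20 a0).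
have [D cD De] := vpsi _ e20.
exists (C `|` D); first exact: compactU.
move=> x /not_orP[/Ce Cx /De Dx].
apply: (le_lt_trans (ler_modulusD _ _)).
rewrite [ltRHS](splitr e) ltr_leD// ?(ltW Dx)//.
rewrite /GRing.scale/= modulusM.
rewrite ltr_pdivlMr// mulrC in Cx.
apply: le_lt_trans Cx.
by rewrite ler_wpM2r ?modulus_ge0// lerDl.
Qed.

HB.instance Definition _ :=
  GRing.isSubmodClosed.Build K (X -> K) C0_pred C0_submod_closed.

End C0.
Arguments C0_pred R k X : clear implicits.

Record C0 (R : realType) (k : scalar_kind) (X : topologicalType) := MkC0 {
  C0_fun :> X -> scalars R k ;
  C0_funP : C0_fun \in C0_pred R k X
}.

Section C0_structures.
Context {R : realType} {k : scalar_kind} {X : topologicalType}.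
Notation C0 := (C0 R k X).
Implicit Types phi psi : C0.

HB.instance Definition _ := [isSub for @C0_fun R k X].
HB.instance Definition _ := [Choice of C0 by <:].
HB.instance Definition _ := [SubChoice_isSubLmodule of C0 by <:].

Definition C0_norm phi : R := fine (supnorm setT phi).

Lemma C0_continuous phi : continuous phi.
Proof. by have /C0_predP[] := C0_funP phi. Qed.

Lemma C0_vanishes phi : vanishes_at_infinity phi.
Proof. by have /C0_predP[] := C0_funP phi. Qed.

Lemma supnorm_C0 phi : supnorm setT phi = (C0_norm phi)%:E.
Proof.
have [M M0 phiM] := C0_bounded (@C0_continuous phi) (@C0_vanishes phi).
rewrite /C0_norm fineK// ge0_fin_numE.
  apply: (@le_lt_trans _ _ M%:E); last exact: ltry.
  apply: ge_ereal_sup => _ [->|[x _ <-]]; first by rewrite lee_fin ltW.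
  by rewrite lee_fin.
by apply: ereal_sup_ubound; left.
Qed.

Lemma C0_norm_ge0 phi : 0 <= C0_norm phi.
Proof. by rewrite -lee_fin -supnorm_C0; apply: ereal_sup_ubound; left. Qed.

Lemma modulus_le_C0_norm phi x : modulus (phi x) <= C0_norm phi.
Proof.
by rewrite -lee_fin -supnorm_C0; apply: ereal_sup_ubound; right; exists x.
Qed.

Lemma C0_norm_le phi (M : R) :
  0 <= M -> (forall x, modulus (phi x) <= M) -> C0_norm phi <= M.
Proof.
move=> M0 phiM; rewrite -lee_fin -supnorm_C0.
by apply: ge_ereal_sup => _ [->|[x _ <-]]; rewrite lee_fin.
Qed.

Lemma C0_ext phi psi : C0_fun phi =1 C0_fun psi -> phi = psi.
Proof. by move=> e; apply: val_inj; exact: funext. Qed.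

Lemma C0_subE phi psi x : (phi - psi) x = phi x - psi x.
Proof. by []. Qed.

Definition C0_dist phi psi : R := C0_norm (phi - psi).

Lemma C0_distxx phi : C0_dist phi phi = 0.
Proof.
apply/eqP; rewrite eq_le C0_norm_ge0 andbT.
by apply: C0_norm_le => // x; rewrite subrr modulus0.
Qed.

Lemma C0_dist_positivity phi psi : C0_dist phi psi = 0 -> phi = psi.
Proof.
move=> d0; apply: C0_ext => x; apply/eqP; rewrite -subr_eq0; apply/eqP.
apply: modulus0_eq0; apply/eqP; rewrite eq_le modulus_ge0 andbT -d0.
exact: (modulus_le_C0_norm (phi - psi)).
Qed.

Lemma C0_dist_sym phi psi : C0_dist phi psi = C0_dist psi phi.
Proof.
by apply/eqP; rewrite eq_le; apply/andP; split;
  apply: C0_norm_le (C0_norm_ge0 _) _ => x; rewrite C0_subE modulusB -C0_subE;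
  exact: modulus_le_C0_norm.
Qed.

Lemma C0_dist_triangle psi phi chi :
  C0_dist phi chi <= C0_dist phi psi + C0_dist psi chi.
Proof.
apply: C0_norm_le => [|x]; first by rewrite addr_ge0 ?C0_norm_ge0.
rewrite -(subrKA psi phi (- chi)) (le_trans (ler_modulusD _ _))//.
by rewrite lerD// modulus_le_C0_norm.
Qed.

HB.instance Definition _ := @isMetric.Build R C0 C0_dist
  C0_distxx C0_dist_positivity C0_dist_sym C0_dist_triangle.

End C0_structures.

Definition LiYorke_chaotic (R : realType) (M : metricType R) (g : M -> M) :=
  continuous g /\
  exists S : set M, ~ countable S /\
    forall x y, S x -> S y -> x <> y ->
      limn_einf (fun n => (mdist (iter n g x) (iter n g y))%:E) = 0%E /\
      (0 < limn_esup (fun n => (mdist (iter n g x) (iter n g y))%:E))%E.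

Section weighted_composition.
Context {R : realType} {k : scalar_kind} {X : topologicalType}.
Context {w : X -> scalars R k} {f : X -> X}.
Hypotheses (cw : continuous w) (bw : bounded_fun w) (cf : continuous f).
Hypothesis wf_compact : forall (e : R) (C : set X), 0 < e -> compact C ->
  compact (f @^-1` C `&` [set x | e <= modulus (w x)]).

Lemma bounded_modulus : exists2 M : R, 0 < M & forall x, modulus (w x) <= M.
Proof.
have [M M0 wM] := pinfty_ex_gt0 bw; have wM' x : `|w x| <= M by exact: wM.
exists (modulus M).
  by rewrite -(@of_real_lt R k) of_real0 -norm_modulus normr_gt0 gt_eqF.
move=> x; rewrite -(@of_real_le R k) -!norm_modulus (le_trans (wM' x))//.
by rewrite gtr0_norm.
Qed.

Lemma wcomp_subproof (phi : C0 R k X) :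
  (fun x => phi (f x) * w x) \in C0_pred R k X.
Proof.
apply/C0_predP; split.
  move=> x; apply: (@continuousM (scalars R k) X (phi \o f) w); last exact: cw.
  by apply: continuous_comp; [exact: cf|exact: C0_continuous].
move=> e e0.
have [M M0 wM] := bounded_modulus.
have [C cC Ce] := C0_vanishes phi (divr_gt0 e0 M0).
have N0 : 0 < C0_norm phi + 1 by rewrite ltr_wpDl// C0_norm_ge0.
exists (f @^-1` C `&` [set x | e / (C0_norm phi + 1) <= modulus (w x)]).
  by apply: wf_compact => //; exact: divr_gt0.
move=> x /not_andP[nCx|/negP]; rewrite modulusM.
  have := Ce _ nCx; rewrite ltr_pdivlMr//; apply: le_lt_trans.
  by rewrite ler_wpM2l// modulus_ge0.
rewrite -ltNge ltr_pdivlMr// mulrC; apply: le_lt_trans.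
rewrite ler_wpM2r ?modulus_ge0// (le_trans (modulus_le_C0_norm _ _))//.
by rewrite lerDl.
Qed.

Definition wcomp (phi : C0 R k X) : C0 R k X := MkC0 (wcomp_subproof phi).

Lemma wcomp_linear : linear wcomp.
Proof.
move=> a phi psi; apply: C0_ext => x.
rewrite -[LHS]/((a * phi (f x) + psi (f x)) * w x).
by rewrite mulrDl -mulrA.
Qed.

Lemma wcomp_bounded :
  exists2 M : R, 0 < M & forall phi, C0_norm (wcomp phi) <= M * C0_norm phi.
Proof.
have [M M0 wM] := bounded_modulus; exists M => // phi.
apply: C0_norm_le => [|x]; first by rewrite mulr_ge0 ?C0_norm_ge0// ltW.
by rewrite modulusM mulrC ler_pM ?modulus_ge0 ?modulus_le_C0_norm.
Qed.

End weighted_composition.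

(* The n-step weight w^(n) = (w \o f^(n-1)) * ... * (w \o f) * w for n >= 1,
   so that iter n (wcomp ...) phi = (phi \o iter n f) * wprod w f n. *)
Definition wprod (R : realType) (k : scalar_kind) (X : Type)
    (w : X -> scalars R k) (f : X -> X) (n : nat) (x : X) : scalars R k :=
  \prod_(i < n) w (iter i f x).

(* Main.v *)
(* Write T for the operator.  By linearity, T is Li-Yorke chaotic if and only if
   some phi is semi-irregular: ||T^n phi|| has lower limit 0 and positive upper
   limit (the real multiples of phi then form the uncountable scrambled set).

   Given such a phi, the sets {|T^m phi| > 1/(i+1)} satisfy (A) because T^m is
   bounded.  If (B) failed with a bound C, then ||T^(n+m) phi|| <= C ||T^m phi||
   for all m and n > 0, and T^n phi would tend to 0.

   Conversely, (B) gives for each natural number p a time k_p and a bump a_p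
   with values in [0, 1] supported in one of the sets B_i, such that
   ||T^(k_p) a_p|| >= p^2.  Along a sequence p_0 < p_1 < ... the supremum phi of
   the functions a_(p_s) / p_s satisfies ||T^(k_(p_s)) phi|| >= p_s, since all
   the bumps are nonnegative.  By (A) there are times m_s at which the bumps
   up to s are small, and if p_(s+1) is large compared with ||T||^(m_s), so are
   the later ones; hence ||T^(m_s) phi|| tends to 0. *)
Require Import Defs.
From mathcomp Require Import all_boot all_order all_algebra.
From mathcomp Require Import all_classical all_reals all_analysis.
Import Order.TTheory GRing.Theory Num.Theory.
Import numFieldNormedType.Exports.
Local Open Scope classical_set_scope.
Local Open Scope ring_scope.

(** * Lower and upper limits of real sequences *)

Section limits_inferior_and_superior.
Context {R : realType}.
Implicit Types u : nat -> R.

Lemma limn_einf_eq0P u : (forall n, 0 <= u n) ->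
  limn_einf (fun n => (u n)%:E) = 0%E <->
  forall (e : R) N, 0 < e -> exists2 n, (N <= n)%N & u n < e.
Proof.
move=> u0; have hl := cvg_lim _ (@cvg_einfs_sup R (fun n => (u n)%:E)).
rewrite limn_einf_lim {}hl//; split.
- move=> sup0 e N e0.
  have : (einfs (fun n => (u n)%:E) N < e%:E)%E.
    rewrite (@le_lt_trans _ _ 0%E) ?lte_fin// -sup0.
    by apply: ereal_sup_ubound; exists N.
  by move=> /ereal_inf_lt[_ [n /= Nn <-]]; rewrite lte_fin; exists n.
- move=> uP; apply/eqP; rewrite eq_le; apply/andP; split.
    apply: ge_ereal_sup => _ [N _ <-].
    apply/lee_addgt0Pr => e e0; rewrite add0e.
    have [n Nn une] := uP e N e0.
    rewrite (@le_trans _ _ (u n)%:E) ?lee_fin ?(ltW une)//.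
    by apply: ereal_inf_lbound; exists n.
  apply: (@le_trans _ _ (einfs (fun n => (u n)%:E) 0)).
    by apply: le_ereal_inf_tmp => _ [n /= _ <-]; rewrite lee_fin.
  by apply: ereal_sup_ubound; exists 0%N.
Qed.

Lemma limn_esup_gt0P u : (0 < limn_esup (fun n => (u n)%:E))%E <->
  exists2 e : R, 0 < e & forall N, exists2 n, (N <= n)%N & e <= u n.
Proof.
have hl := cvg_lim _ (@cvg_esups_inf R (fun n => (u n)%:E)).
rewrite limn_esup_lim {}hl//; split.
- apply: contraPP => uN; apply/negP; rewrite -leNgt.
  apply/lee_addgt0Pr => e e0; rewrite add0e.
  have /existsNP[N uNe] : ~ forall N, exists2 n, (N <= n)%N & e <= u n.
    by move=> ue; apply: uN; exists e.
  apply: (@le_trans _ _ (esups (fun n => (u n)%:E) N)).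
    by apply: ereal_inf_lbound; exists N.
  apply: ge_ereal_sup => _ [n /= Nn <-]; rewrite lee_fin leNgt.
  by apply/negP => /ltW une; apply: uNe; exists n.
- move=> [e e0 ue]; apply: (@lt_le_trans _ _ e%:E); first by rewrite lte_fin.
  apply: le_ereal_inf_tmp => _ [N _ <-]; have [n Nn une] := ue N.
  apply: (@le_trans _ _ (u n)%:E); first by rewrite lee_fin.
  by apply: ereal_sup_ubound; exists n.
Qed.

End limits_inferior_and_superior.

(** A countable set is Lebesgue null, whereas [[0, 1]] has measure 1. *)
Lemma uncountable_real (R : realType) : ~ countable [set: R].
Proof.
move=> cR; have : countable [set` `[(0 : R), 1]].
  by apply: sub_countable cR; exact/subset_card_le.
move=> /countable_lebesgue_measure0.
by rewrite lebesgue_measure_itv/= lte_fin ltr01 oppr0 adde0 => /eqP; rewrite eqe oner_eq0.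
Qed.

(** * Suprema of moduli over subsets, and the norm of [C0] *)

Section uniform_norm.
Context {R : realType} {k : scalar_kind} {X : topologicalType}.
Implicit Types (phi psi : C0 R k X) (B : set X).
Local Open Scope ereal_scope.

Lemma supnorm_ge0 B (phi : X -> scalars R k) : 0 <= supnorm B phi.
Proof. by apply: ereal_sup_ubound; left. Qed.

Lemma modulus_le_supnorm B (phi : X -> scalars R k) x : B x ->
  (modulus (phi x))%:E <= supnorm B phi.
Proof. by move=> Bx; apply: ereal_sup_ubound; right; exists x. Qed.

Lemma supnorm_leP B (phi : X -> scalars R k) (M : \bar R) : 0 <= M ->
  supnorm B phi <= M <-> forall x, B x -> (modulus (phi x))%:E <= M.
Proof.
move=> M0; split=> [BM x Bx|BM].
  exact: le_trans (modulus_le_supnorm _ _ _ Bx) BM.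
by apply: ge_ereal_sup => _ [->|[x Bx <-]]; last exact: BM.
Qed.

Local Close Scope ereal_scope.

Lemma modulus_of_real (r : R) : modulus (of_real r : scalars R k) = `|r|.
Proof.
case: k => //=.
by rewrite expr0n/= addr0 sqrtr_sqr.
Qed.

Lemma modulus1 : modulus (1 : scalars R k) = 1.
Proof. by apply: (@of_real_inj R k); rewrite -norm_modulus normr1; case: k. Qed.

Lemma of_real_continuous : continuous (of_real : R -> scalars R k).
Proof.
move=> x; apply/(@cvgrPdist_lt _ (scalars R k)) => e e0.
(* The positive scalar [e] equals [of_real (modulus e)], which turns the estimate into one in
   [R]. *)
have e'0 : 0 < modulus e.
  by rewrite -(@of_real_lt R k) of_real0 -norm_modulus normr_gt0 gt_eqF.
near=> y.
have of_realB : of_real x - of_real y = of_real (x - y) :> scalars R k.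
  apply/eqP; rewrite subr_eq -of_realD subrK//.
rewrite of_realB norm_modulus modulus_of_real -[ltRHS]gtr0_norm//.
rewrite [ltRHS]norm_modulus of_real_lt.
by near: y; apply: (@cvgrPdist_lt _ R^o _ (nbhs x) _ _ _).1.
Unshelve. all: by end_near. Qed.

Lemma C0_scaleE (c : scalars R k) phi x : (c *: phi) x = c * phi x.
Proof. by []. Qed.

Lemma C0_normZ (c : scalars R k) phi : C0_norm (c *: phi) = modulus c * C0_norm phi.
Proof.
have le_normZ (d : scalars R k) psi : C0_norm (d *: psi) <= modulus d * C0_norm psi.
  apply: C0_norm_le => [|x]; first by rewrite mulr_ge0 ?modulus_ge0 ?C0_norm_ge0.
  by rewrite C0_scaleE modulusM ler_wpM2l ?modulus_ge0 ?modulus_le_C0_norm.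
apply/eqP; rewrite eq_le le_normZ/=.
have [->|c0] := eqVneq c 0; first by rewrite modulus0 mul0r C0_norm_ge0.
(* The reverse inequality is [le_normZ] for the scalar [c^-1] and the function [c *: phi]. *)
rewrite -[in leLHS](scalerK c0 phi).
rewrite (le_trans (ler_wpM2l (modulus_ge0 _) (le_normZ _ _)))//.
by rewrite mulrA -modulusM divff// modulus1 mul1r.
Qed.

End uniform_norm.

(** * Orbits of the operator and the reduction to semi-irregular functions *)

Section weighted_composition_orbits.
Context {R : realType} {k : scalar_kind} {X : topologicalType}.
Context {w : X -> scalars R k} {f : X -> X}.
Hypotheses (cw : continuous w) (bw : bounded_fun w) (cf : continuous f).
Hypothesis wf_compact : forall (e : R) (C : set X), 0 < e -> compact C ->
  compact (f @^-1` C `&` [set x | e <= modulus (w x)]).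
Implicit Types (phi psi : C0 R k X) (B : set X).
Let T := wcomp cw bw cf wf_compact.

Lemma wcompE phi x : T phi x = phi (f x) * w x.
Proof. by []. Qed.

Lemma iter_wcompE n phi x : iter n T phi x = phi (iter n f x) * wprod w f n x.
Proof.
elim: n x => [|n IHn] x; first by rewrite /wprod big_ord0 mulr1.
rewrite iterS wcompE IHn -iterSr -mulrA; congr (_ * _).
rewrite /wprod big_ord_recl mulrC; congr (_ * _).
by apply: eq_bigr => i _; rewrite -iterSr.
Qed.

Lemma modulus_iter_wcomp n phi x :
  modulus (iter n T phi x) = modulus (phi (iter n f x)) * modulus (wprod w f n x).
Proof. by rewrite iter_wcompE modulusM. Qed.

Lemma iter_wcompB n phi psi : iter n T (phi - psi) = iter n T phi - iter n T psi.
Proof. by apply: C0_ext => x; rewrite C0_subE !iter_wcompE -mulrBl. Qed.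

Lemma iter_wcompZ n c phi : iter n T (c *: phi) = c *: iter n T phi.
Proof.
by apply: C0_ext => x; rewrite iter_wcompE !C0_scaleE iter_wcompE mulrA.
Qed.

Lemma norm_iter_wcomp_le : exists2 M : R, 0 < M &
  forall n phi, C0_norm (iter n T phi) <= M ^+ n * C0_norm phi.
Proof.
have [M M0 TM] := wcomp_bounded cw bw cf wf_compact; exists M => // n phi.
elim: n => [|n IHn]; first by rewrite mul1r.
by rewrite iterS (le_trans (TM _))// exprS -mulrA ler_wpM2l// ltW.
Qed.

(** If [iter n f x] lies in [B], then [iter n T phi x] has modulus at least
    [c * modulus (wprod w f n x)]. Small orbit norms thus force small weights, which is the source
    of (A). *)
Lemma supnorm_wprod_le n phi B (c : R) : 0 < c ->
  (forall x, B x -> c <= modulus (phi x)) ->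
  (supnorm (iter n f @^-1` B) (wprod w f n) <= (c^-1 * C0_norm (iter n T phi))%:E)%E.
Proof.
move=> c0 Bc; apply/supnorm_leP => [|x Bx].
  by rewrite lee_fin mulr_ge0 ?invr_ge0 ?(ltW c0) ?C0_norm_ge0.
rewrite lee_fin mulrC ler_pdivlMr// mulrC.
rewrite (le_trans _ (modulus_le_C0_norm _ x))// modulus_iter_wcomp.
by rewrite ler_wpM2r ?modulus_ge0 ?Bc.
Qed.

Lemma wcomp_continuous : continuous T.
Proof.
have [M M0 TM] := wcomp_bounded cw bw cf wf_compact.
move=> phi; have FF : Filter (nbhs phi) by exact: nbhs_filter.
apply/cvg_ballP => e e0.
apply: (@filterS _ (nbhs phi) _ (ball phi (e / M))); last first.
  by apply: nbhsx_ballx; exact: divr_gt0.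
move=> psi; rewrite !ballEmdist/= => phipsi.
(* [T] is written as its own first iterate so that [iter_wcompB] applies. *)
rewrite -[mdist _ _]/(C0_norm (iter 1 T phi - iter 1 T psi)) -iter_wcompB.
by rewrite (le_lt_trans (TM _))// mulrC -ltr_pdivlMr.
Qed.

Definition semi_irregular phi :=
  (forall (e : R) N, 0 < e -> exists2 n, (N <= n)%N & C0_norm (iter n T phi) < e) /\
  exists2 e : R, 0 < e & forall N, exists2 n, (N <= n)%N & e <= C0_norm (iter n T phi).

Lemma LiYorke_pairP phi psi :
  limn_einf (fun n => (mdist (iter n T phi) (iter n T psi))%:E) = 0%E /\
  (0 < limn_esup (fun n => (mdist (iter n T phi) (iter n T psi))%:E))%E <->
  semi_irregular (phi - psi).
Proof.
have -> : (fun n => (mdist (iter n T phi) (iter n T psi))%:E) =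
    (fun n => (C0_norm (iter n T (phi - psi)))%:E).
  by apply/funext => n; rewrite iter_wcompB.
by rewrite limn_esup_gt0P limn_einf_eq0P// => n; exact: C0_norm_ge0.
Qed.

Lemma semi_irregularZ c phi : c != 0 -> semi_irregular phi -> semi_irregular (c *: phi).
Proof.
move=> c0 [phi_inf [e e0 phi_sup]].
have mc0 : 0 < modulus c.
  rewrite lt_neqAle modulus_ge0 andbT eq_sym.
  by apply: contra_neq c0; exact: modulus0_eq0.
split=> [d N d0|].
  have [n Nn phin] := phi_inf (d / modulus c) N (divr_gt0 d0 mc0); exists n => //.
  by rewrite iter_wcompZ C0_normZ mulrC -ltr_pdivlMr.
exists (modulus c * e); first exact: mulr_gt0.
move=> N; have [n Nn phin] := phi_sup N; exists n => //.
by rewrite iter_wcompZ C0_normZ ler_pM2l.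
Qed.

Lemma LiYorke_chaotic_semi_irregularP :
  LiYorke_chaotic T <-> exists phi, semi_irregular phi.
Proof.
split=> [[_ [S [ucS SP]]]|[phi irr]].
  (* Of the uncountability of [S], only the existence of two distinct elements enters here. *)
  have : ~ (forall phi psi, S phi -> S psi -> phi = psi).
    move=> S1; apply: ucS; have [->|/set0P[phi Sphi]] := eqVneq S set0.
      exact: countable0.
    suff -> : S = [set phi] by exact: countable1.
    by apply/seteqP; split=> [psi Spsi|_ ->//]; exact: S1.
  move=> /existsNP[phi /existsNP[psi /not_implyP[Sphi /not_implyP[Spsi phipsi]]]].
  by exists (phi - psi); apply/LiYorke_pairP; exact: SP.
split; first exact: wcomp_continuous.
exists [set of_real c *: phi | c in [set: R]].
have of_realB a b : of_real a - of_real b = of_real (a - b) :> scalars R k.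
  by apply/eqP; rewrite subr_eq -of_realD subrK.
(* The orbit of 0 has upper limit 0. Since [phi] is nonzero, distinct reals give distinct multiples
   of it. *)
have phi0 : phi != 0.
  apply/eqP => phi0; have [_ [e e0 /(_ 0%N)[n _]]] := irr.
  rewrite phi0 -(scale0r 0) iter_wcompZ C0_normZ modulus0 mul0r.
  by move=> /(lt_le_trans e0); rewrite ltxx.
split.
  move=> cS; apply: (@uncountable_real R); apply: sub_countable cS.
  have Zphi_inj : injective (fun c : R => of_real c *: phi).
    move=> a b /eqP; rewrite -subr_eq0 -scalerBl scaler_eq0 (negPf phi0) orbF.
    by rewrite subr_eq0 => /eqP/of_real_inj.
  have := @inj_card_eq _ _ [set: R] _ (in2W Zphi_inj).
  by rewrite card_eq_le => /andP[].
move=> _ _ [a _ <-] [b _ <-] ab; apply/LiYorke_pairP.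
rewrite -scalerBl of_realB; apply: semi_irregularZ => //.
by rewrite -of_realB subr_eq0; apply/eqP => ab'; apply: ab; rewrite ab'.
Qed.

End weighted_composition_orbits.

(** * Bump functions and their suprema *)

Lemma near_all_ltn {T : Type} (F : set_system T) (Q : nat -> T -> Prop) N :
  Filter F -> (forall s, \forall x \near F, Q s x) ->
  \forall x \near F, forall s, (s < N)%N -> Q s x.
Proof.
move=> FF FQ; elim: N => [|N IHN]; first by apply: nearW.
apply: filterS2 IHN (FQ N) => x QN QNx s; rewrite ltnS leq_eqVlt => /predU1P[->//|].
exact: QN.
Qed.

Lemma exists_invn_lt {R : realType} (e : R) : 0 < e -> exists N : nat, N.+1%:R^-1 < e.
Proof.
move=> e0; exists (Num.bound e^-1).
rewrite invf_plt ?posrE// (lt_trans (archi_boundP _)) ?invr_ge0 ?(ltW e0)//.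
by rewrite ltr_nat.
Qed.

Section supremum_of_bumps.
Context {R : realType} {k : scalar_kind} {X : topologicalType}.
Variable b : nat -> X -> R.
Hypothesis cb : forall s, continuous (b s).
Hypothesis b0 : forall s x, 0 <= b s x.
Hypothesis b_le : forall s x, b s x <= s.+1%:R^-1.
Hypothesis b_supp : forall s, exists2 C : set X, compact C & forall x, ~ C x -> b s x = 0.

Let g x := sup (range (b^~ x)).

Let b_le_g s x : b s x <= g x.
Proof.
apply: ub_le_sup; last by exists s.
exists 1 => _ [t _ <-]; rewrite (le_trans (b_le t x))//.
by rewrite invf_le1 ?ler1n.
Qed.

Let g_le x M : (forall s, b s x <= M) -> g x <= M.
Proof. by move=> bM; apply: ge_sup => [|_ [s _ <-]//]; exists (b 0%N x), 0%N. Qed.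

Let g_ge0 x : 0 <= g x.
Proof. exact: le_trans (b_le_g 0%N x). Qed.

(** Bumps of index at least [N] stay below [e], so a variation of [g] beyond [e] could only come
    from the first [N] bumps, which are finitely many continuous functions. *)
Let g_continuous : continuous g.
Proof.
move=> x; have FF : Filter (nbhs x) by exact: nbhs_filter.
apply/(@cvgrPdist_le _ R^o) => e e0.
have [N Ne] := exists_invn_lt e e0.
have near_b : \forall y \near x, forall s, (s < N)%N -> `|b s x - b s y| <= e.
  apply: near_all_ltn => s.
  exact: (@cvgrPdist_le _ R^o _ (nbhs x) _ _ _).1 (cb s x) e e0.
(* This one-sided estimate is applied to both orders of the pair. For [s >= N] it uses only
   [b s y <= e] and [0 <= g z]. *)
have g_leD y z : (forall s, (s < N)%N -> `|b s y - b s z| <= e) -> g y <= g z + e.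
  move=> yz; apply: g_le => s; have [sN|Ns] := ltnP s N.
    rewrite -lerBlDr (le_trans _ (b_le_g s z))// lerBlDr -lerBlDl.
    exact: le_trans (ler_norm _) (yz s sN).
  rewrite (le_trans (b_le s y))// -[leLHS]add0r lerD ?g_ge0//.
  by rewrite (le_trans _ (ltW Ne))// lef_pV2 ?posrE// ler_nat.
apply: filterS near_b => y xy.
have yx s : (s < N)%N -> `|b s y - b s x| <= e by move=> /xy; rewrite distrC.
by rewrite ler_distl lerBlDr (g_leD _ _ xy) (g_leD _ _ yx).
Qed.

(** The two conclusions together characterize [modulus (phi x)] as the supremum of the [b s x].
    Vanishing at infinity follows from the decay of the bounds: outside the union of the first [N]
    supports only small bumps survive. *)
Lemma C0_sup_bumps : exists phi : C0 R k X,
  (forall s x, b s x <= modulus (phi x)) /\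
  (forall x M, (forall s, b s x <= M) -> modulus (phi x) <= M).
Proof.
have modg x : modulus (of_real (g x) : scalars R k) = g x.
  by rewrite modulus_of_real ger0_norm.
suff gC0 : (fun x => of_real (g x)) \in C0_pred R k X.
  exists (MkC0 gC0); split=> [s x|x M bM] /=; rewrite modg.
    exact: b_le_g.
  exact: g_le.
apply/C0_predP; split.
  by move=> x; apply: continuous_comp; [exact: g_continuous|exact: of_real_continuous].
move=> e e0; have [N Ne] := exists_invn_lt e e0.
have [C cC bC] : exists2 C, compact C &
    forall s, (s < N)%N -> forall x, ~ C x -> b s x = 0.
  elim: N {Ne} => [|N [C cC bC]]; first by exists set0 => //; exact: compact0.
  have [D cD bD] := b_supp N; exists (C `|` D); first exact: compactU.
  move=> s; rewrite ltnS leq_eqVlt => /predU1P[->|sN] x /not_orP[Cx Dx].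
    exact: bD.
  exact: bC.
exists C => // x Cx; rewrite modg (le_lt_trans _ Ne)//.
apply: g_le => s; have [sN|Ns] := ltnP s N; first by rewrite bC// invr_ge0.
by rewrite (le_trans (b_le s x))// lef_pV2 ?posrE// ler_nat.
Qed.

End supremum_of_bumps.

(** Locally compact Hausdorff spaces are completely regular, so [y] can be separated from the closed
    complement of [B]. The separating function is 0 at [y] and 1 off [B], hence the witness
    [1 - g]. *)
Lemma locally_compact_bump {R : realType} {X : topologicalType} (B : set X) (y : X) :
  locally_compact [set: X] -> hausdorff_space X -> open B -> B y ->
  exists a : X -> R, [/\ continuous a, forall x, 0 <= a x <= 1, a y = 1 &
    forall x, ~ B x -> a x = 0].
Proof.
move=> lcX hX oB By.
have := @locally_compact_completely_regular X R lcX hX y (~` B) (open_closedC oB).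
move=> /(_ (fun nBy => nBy By))/(@uniform_separatorP _ R)[g [cg g01 gy gB]].
exists (fun x => 1 - g x); split.
- move=> x; apply: (@continuousB _ R^o); [exact: cvg_cst|exact: cg].
- move=> x; have : `[0, 1]%classic (g x) by apply: g01; exists x.
  by rewrite /= in_itv/= => /andP[g0 g1]; rewrite subr_ge0 g1 lerBlDl lerDr.
- by rewrite (gy (g y)) ?subr0//; exists y.
- by move=> x Bx; rewrite (gB (g x)) ?subrr//; exists x.
Qed.

(** * The two implications of the criterion *)

Section criterion.
Context {R : realType} {k : scalar_kind} {X : topologicalType}.
Context {w : X -> scalars R k} {f : X -> X}.
Hypotheses (cw : continuous w) (bw : bounded_fun w) (cf : continuous f).
Hypothesis wf_compact : forall (e : R) (C : set X), 0 < e -> compact C ->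
  compact (f @^-1` C `&` [set x | e <= modulus (w x)]).
Let T := wcomp cw bw cf wf_compact.

Lemma modulus_wprod_le : exists2 M : R, 0 < M &
  forall n x, modulus (wprod w f n x) <= M ^+ n.
Proof.
have [M M0 wM] := bounded_modulus bw; exists M => // n x.
elim: n => [|n IHn]; first by rewrite /wprod big_ord0 modulus1.
by rewrite /wprod big_ord_recr/= modulusM exprSr ler_pM ?modulus_ge0.
Qed.

Lemma semi_irregular_weights (hausdorffX : hausdorff_space X) (phi : C0 R k X) :
  semi_irregular cw bw cf wf_compact phi ->
  exists B : nat -> set X,
    (forall i, open (B i) /\ precompact (B i)) /\
    (exists n : nat -> nat,
      (forall j, (0 < n j)%N) /\
      {homo n : i j / (i < j)%N} /\
      forall i,
        supnorm (iter (n j) f @^-1` B i) (wprod w f (n j)) @[j --> \oo]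
          --> 0%E) /\
    ereal_sup [set supnorm (iter n f @^-1` B i) (wprod w f n) |
                 i in [set: nat] & n in [set n : nat | (0 < n)%N]] = +oo%E.
Proof.
move=> [phi_inf phi_sup]; have [M M0 TM] := norm_iter_wcomp_le cw bw cf wf_compact.
pose U (mi : nat * nat) := [set x | mi.2.+1%:R^-1 < modulus (iter mi.1 T phi x)].
(* An index that encodes no pair receives [U (0, 0)], already a member of the family. *)
pose B i := U (odflt (0, 0)%N (unpickle i)).
have B_pickle mi : B (pickle mi) = U mi by rewrite /B pickleK.
exists B; split; last split.
- move=> i; rewrite /B; case: (odflt _ _) => m {}i; split.
    apply: (@open_comp _ _ (fun x => modulus (iter m T phi x)) [set r | i.+1%:R^-1 < r]).
      move=> x _; apply: continuous_comp; first exact: C0_continuous.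
      exact: modulus_continuous.
    exact: open_gt.
  have [C cC Ci] : exists2 C, compact C & U (m, i) `<=` C.
    have i0 : 0 < i.+1%:R^-1 :> R by rewrite invr_gt0.
    have [C cC CU] := C0_vanishes (iter m T phi) i0.
    by exists C => // x /= Ux; apply: contrapT => /CU; rewrite ltNge (ltW Ux).
  exact: precompact_subset Ci (compact_precompact hausdorffX cC).
- have /choice[h hP] q : exists n, (q < n)%N /\ C0_norm (iter n T phi) < q.+1%:R^-1.
    have [|n qn phin] := phi_inf q.+1%:R^-1 q.+1; first by rewrite invr_gt0.
    by exists n.
  have iter_h j : (j <= iter j h 0)%N.
    elim: j => // j IHj; rewrite iterS (leq_ltn_trans IHj)//.
    by have [] := hP (iter j h 0%N).
  (* The shift to [j.+1] makes the times positive and writes each as [h] of a number at least [j],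
     so the orbit norm there is below [j.+1%:R^-1]. *)
  exists (fun j => iter j.+1 h 0%N); split; last split.
  + by move=> j; exact: leq_trans (iter_h j.+1).
  + apply: homo_ltn => [|i]; first exact: ltn_trans.
    by rewrite [in ltnRHS]iterS; have [] := hP (iter i.+1 h 0%N).
  + move=> i; rewrite /B; case: (odflt _ _) => m {}i.
    (* The factor [i.+1] inverts the threshold defining [U (m, i)]. The factor [M ^+ m] bounds the
       norm of [iter m T], once it is commuted past [iter n T]. *)
    pose c := i.+1%:R * M ^+ m.
    apply: (@squeeze_cvge _ _ _ _ (cst 0%E) _ (fun j => (c * harmonic j)%:E)).
    * apply: nearW => j; rewrite supnorm_ge0/=; set n := iter j.+1 h 0%N.
      have Ui x : U (m, i) x -> i.+1%:R^-1 <= modulus (iter m T phi x) by move=> /ltW.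
      rewrite (le_trans (supnorm_wprod_le cw bw cf wf_compact n _ _ _ _ Ui)) ?invr_gt0//.
      rewrite lee_fin invrK -iterD addnC iterD -mulrA ler_wpM2l// (le_trans (TM _ _))//.
      rewrite ler_wpM2l ?exprn_ge0 ?(ltW M0)//.
      have [_ /ltW/le_trans->//] := hP (iter j h 0%N).
      by rewrite lef_pV2 ?posrE// ler_nat ltnS.
    * exact: cvg_cst.
    * apply: cvg_EFin; first exact: nearW.
      rewrite -(mulr0 c); apply: cvgMl_tmp; exact: cvg_harmonic.
- apply: contrapT => sup_fin.
  set s := ereal_sup _ in sup_fin.
  have le_s mi n : (0 < n)%N -> (supnorm (iter n f @^-1` U mi) (wprod w f n) <= s)%E.
    move=> n0; apply: ereal_sup_ubound; exists (pickle mi) => //.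
    by exists n; rewrite ?B_pickle.
  have [C C0 sC] : exists2 C : R, 0 <= C & s = C%:E.
    have : (0 <= s)%E by exact: le_trans (supnorm_ge0 _ _) (le_s (0, 0)%N 1%N _).
    by case: s sup_fin {le_s} => [C _|//|]; [exists C|rewrite leeNy_eq].
  (* For fixed [m] the sets [U (m, i)] exhaust the points where [iter m T phi] is nonzero. Hence [C]
     bounds the weight at every [x] for which [iter m T phi] is nonzero at [iter n f x]. *)
  have TC m n : (0 < n)%N -> C0_norm (iter (n + m) T phi) <= C * C0_norm (iter m T phi).
    move=> n0; apply: C0_norm_le => [|x]; first by rewrite mulr_ge0 ?C0_norm_ge0.
    rewrite iterD modulus_iter_wcomp mulrC.
    set r := modulus (iter m T phi (iter n f x)).
    have [r0|r0] := leP r 0.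
      rewrite (le_trans (mulr_ge0_le0 (modulus_ge0 _) r0))//.
      by rewrite mulr_ge0 ?C0_norm_ge0.
    have [i ir] := exists_invn_lt r r0.
    rewrite ler_pM ?modulus_ge0 ?modulus_le_C0_norm// -lee_fin -sC.
    by rewrite (le_trans _ (le_s (m, i) n n0))// modulus_le_supnorm.
  have [e e0 phie] := phi_sup.
  have C1 : 0 < C + 1 by rewrite ltr_wpDl.
  (* Dividing by [C + 1] covers the case [C = 0]. The later time [n] is taken strictly past [m], as
     [TC] needs a positive number of steps. *)
  have [m _ phim] := phi_inf (e / (C + 1)) 0%N (divr_gt0 e0 C1).
  have [n mn] := phie m.+1; apply/negP; rewrite -ltNge.
  rewrite -(subnK (ltnW mn)) (le_lt_trans (TC _ _ _)) ?subn_gt0//.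
  rewrite ltr_pdivlMr// in phim; apply: le_lt_trans phim.
  by rewrite mulrC ler_wpM2l ?C0_norm_ge0// lerDl.
Qed.

Lemma weights_semi_irregular (locally_compactX : locally_compact [set: X])
  (hausdorffX : hausdorff_space X) (B : nat -> set X) (n : nat -> nat) :
  (forall i, open (B i) /\ precompact (B i)) ->
  {homo n : i j / (i < j)%N} ->
  (forall i, supnorm (iter (n j) f @^-1` B i) (wprod w f (n j)) @[j --> \oo] --> 0%E) ->
  ereal_sup [set supnorm (iter n f @^-1` B i) (wprod w f n) |
               i in [set: nat] & n in [set n : nat | (0 < n)%N]] = +oo%E ->
  exists phi : C0 R k X, semi_irregular cw bw cf wf_compact phi.
Proof.
move=> oB n_homo B_to0 B_sup; have [M M0 wM] := modulus_wprod_le.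
have le_n j : (j <= n j)%N.
  by elim: j => // j IHj; exact: leq_ltn_trans IHj (n_homo _ _ (ltnSn j)).
(* Each [p] gets a set [B (t p).1.1], a time [(t p).1.2] and a bump [(t p).2]
   supported in that set such that [p^-1] times the bump has norm at least [p]
   at that time. *)
have /choice[t tP] (p : nat) : exists t : nat * nat * (X -> R),
    [/\ continuous t.2, forall x, 0 <= t.2 x <= 1,
        forall x, ~ B t.1.1 x -> t.2 x = 0 &
        exists x, t.2 (iter t.1.2 f x) = 1 /\
          p%:R ^+ 2 <= modulus (wprod w f t.1.2 x)].
  have : ((p%:R ^+ 2 : R)%:E < +oo)%E by rewrite ltry.
  rewrite -B_sup => /ereal_sup_gt[_ [i _ [m _ <-]]] sup_gt.
  have [x [Bx wx]] : exists x, B i (iter m f x) /\ p%:R ^+ 2 <= modulus (wprod w f m x).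
    apply: contrapT => /forallNP wp; move: sup_gt; apply/negP; rewrite -leNgt.
    apply/supnorm_leP => [|x Bx]; first by rewrite lee_fin sqr_ge0.
    rewrite lee_fin; case/not_andP: (wp x) => [/(_ Bx)//|/negP].
    by rewrite -ltNge => /ltW.
  have [a [ca a01 ax aB]] :=
    locally_compact_bump (R := R) _ _ locally_compactX hausdorffX (oB i).1 Bx.
  by exists (i, m, a); split => //; exists x.
(* Finitely many of the limits in (A) are used at once: at time [m q] the weights over the sets of
   all bumps up to [q] are small. *)
have /choice[m mP] (q : nat) : exists m, (q <= m)%N /\ forall p, (p <= q)%N ->
    forall x, B (t p).1.1 (iter m f x) -> modulus (wprod w f m x) <= q.+1%:R^-1.
  have : \forall j \near \oo, forall p, (p < q.+1)%N ->
      (supnorm (iter (n j) f @^-1` B (t p).1.1) (wprod w f (n j)) < q.+1%:R^-1%:E)%E.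
    apply: near_all_ltn => p.
    apply: (B_to0 (t p).1.1 [set y | y < q.+1%:R^-1%:E]%E).
    apply: open_nbhs_nbhs; split; first exact: open_ereal_lt_ereal.
    by rewrite /= lte_fin invr_gt0.
  move=> [J _ /(_ (maxn J q) (leq_maxl J q)) nJ]; exists (n (maxn J q)); split.
    exact: leq_trans (leq_maxr J q) (le_n _).
  move=> p pq x Bx; rewrite -lee_fin (le_trans _ (ltW (nJ p pq)))//.
  exact: modulus_le_supnorm.
have bound_ge0 q : 0 <= q.+1%:R * M ^+ m q by rewrite mulr_ge0 ?exprn_ge0 ?(ltW M0).
(* The first summand makes the sequence increase strictly. By the second, a bump divided by at least
   [P q] still contributes at most [q.+1%:R^-1] at time [m q]. *)
pose P q := (q.+1 + Num.bound (q.+1%:R * M ^+ m q))%N.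
have P_gt q : q.+1%:R * M ^+ m q <= (P q)%:R.
  by rewrite (le_trans (ltW (archi_boundP (bound_ge0 q))))// ler_nat leq_addl.
(* Starting at 1 gives [s < p s], so that [(p s)%:R^-1] is at most the bound [s.+1%:R^-1] of
   [C0_sup_bumps]. *)
pose p s := iter s P 1%N.
have p_lt : {homo p : r s / (r < s)%N}.
  by apply: homo_ltn => [|s]; [exact: ltn_trans|rewrite [p s.+1]iterS leq_addr].
have lt_p s : (s < p s)%N.
  by elim: s => // s IHs; exact: leq_ltn_trans IHs (p_lt _ _ (ltnSn s)).
have p_le : {homo p : r s / (r <= s)%N}.
  by move=> r s; rewrite leq_eqVlt => /predU1P[->//|/p_lt/ltnW].
have p0 s : 0 < (p s)%:R :> R by rewrite ltr0n (leq_trans _ (lt_p s)).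
pose b s x := (p s)%:R^-1 * (t (p s)).2 x.
have b_le s x : b s x <= (p s)%:R^-1.
  have [_ /(_ x)/andP[_ t1] _ _] := tP (p s).
  by rewrite -[leRHS]mulr1 ler_wpM2l// invr_ge0 ltW.
have b0 s x : 0 <= b s x.
  have [_ /(_ x)/andP[t0 _] _ _] := tP (p s).
  by rewrite mulr_ge0// invr_ge0 ltW.
have b_supp s x : ~ B (t (p s)).1.1 x -> b s x = 0.
  by have [_ _ tB _] := tP (p s) => /tB; rewrite /b => ->; rewrite mulr0.
have [||||phi [b_le_phi phi_le]] := @C0_sup_bumps R k X b.
- move=> s x; apply: (@continuousM R X); first exact: cvg_cst.
  by have [ct _ _ _] := tP (p s); exact: ct.
- exact: b0.
- by move=> s x; rewrite (le_trans (b_le s x))// lef_pV2 ?posrE// ler_nat.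
- move=> s; have [_ [C BC [cC _]]] := oB (t (p s)).1.1.
  by exists C => // x Cx; apply: b_supp => /BC.
exists phi; split=> [e N e0|].
- have [s se] := exists_invn_lt e e0; pose r := maxn s N; exists (m (p r)).
    rewrite (leq_trans _ (mP (p r)).1)// (leq_trans _ (ltnW (lt_p r)))//.
    exact: leq_maxr.
  apply: le_lt_trans se; apply: (@le_trans _ _ (p r).+1%:R^-1); last first.
    rewrite lef_pV2 ?posrE// ler_nat ltnS (leq_trans (leq_maxl s N))//.
    exact: ltnW (lt_p r).
  have [_ mr] := mP (p r); set l := m (p r) in mr *.
  apply: C0_norm_le => [|x]; first by rewrite invr_ge0.
  rewrite modulus_iter_wcomp; set y := iter l f x.
  (* A positive weight can be divided out, and [phi_le] then reduces the estimate to single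
     bumps. *)
  have [w0|w0] := leP (modulus (wprod w f l x)) 0.
    by rewrite (le_trans (mulr_ge0_le0 (modulus_ge0 _) w0))// invr_ge0.
  rewrite -ler_pdivlMr//; apply: phi_le => u; rewrite ler_pdivlMr//.
  have [ur|ru] := leqP u r.
    have [By|/b_supp->] := pselect (B (t (p u)).1.1 y); last by rewrite mul0r invr_ge0.
    rewrite -[leRHS]mul1r ler_pM ?modulus_ge0//; last first.
      exact: mr (p_le _ _ ur) _ By.
    rewrite (le_trans (b_le u y))// invf_le1 ?ler1n//.
    exact: leq_trans (lt_p u).
  (* For the later bumps the crude bound [M ^+ l] on the weight suffices, because [p u] is at least
     [P (p r)]. *)
  apply: (@le_trans _ _ ((p u)%:R^-1 * M ^+ l)).
    by rewrite ler_pM ?modulus_ge0.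
  rewrite mulrC ler_pdivrMr// mulrC ler_pdivlMr// mulrC.
  rewrite (le_trans (P_gt (p r)))// ler_nat.
  exact: (p_le r.+1 u).
exists 1 => // N; have [L L0 TL] := norm_iter_wcomp_le cw bw cf wf_compact.
(* [D] bounds the orbit norms at all times before [N]; the base [L + 1] is at least 1, so its powers
   are monotone. As [p s > s > D], the time [l] at which the norm reaches [p s] cannot precede
   [N]. *)
pose D := (L + 1) ^+ N * C0_norm phi.
have D0 : 0 <= D by rewrite mulr_ge0 ?C0_norm_ge0 ?exprn_ge0 ?addr_ge0 ?(ltW L0).
pose s := Num.bound D; have [_ _ _ [x [tx wx]]] := tP (p s).
set l := (t (p s)).1.2 in tx wx.
have phil : (p s)%:R <= C0_norm (iter l T phi).
  rewrite (le_trans _ (modulus_le_C0_norm _ x))// modulus_iter_wcomp.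
  (* The bump with factor [(p s)%:R^-1] equals 1 at [iter l f x], and the weight is at least the
     square of [p s], which leaves [p s]. *)
  rewrite (le_trans _ (ler_pM _ _ (b_le_phi s _) wx)) ?sqr_ge0//.
  by rewrite /b tx mulr1 expr2 mulKf// gt_eqF.
exists l; last by rewrite (le_trans _ phil)// ler1n (leq_trans _ (lt_p s)).
rewrite leqNgt; apply/negP => lN.
have : C0_norm (iter l T phi) <= D.
  rewrite (le_trans (TL _ _))// ler_wpM2r ?C0_norm_ge0//.
  rewrite (@le_trans _ _ ((L + 1) ^+ l))//.
    by rewrite lerXn2r ?nnegrE ?addr_ge0 ?(ltW L0)// lerDl.
  by rewrite ler_weXn2l ?lerDr ?(ltW L0)// ltnW.
apply/negP; rewrite -ltNge (lt_le_trans (archi_boundP D0))//.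
by rewrite (le_trans _ phil)// ler_nat ltnW.
Qed.

End criterion.

Theorem theorem1 (R : realType) (k : scalar_kind) (X : topologicalType)
  (locally_compactX : locally_compact [set: X])
  (hausdorffX : hausdorff_space X)
  (w : X -> scalars R k) (cw : continuous w) (bw : bounded_fun w)
  (f : X -> X) (cf : continuous f)
  (wf_compact : forall (e : R) (C : set X), 0 < e -> compact C ->
    compact (f @^-1` C `&` [set x | e <= modulus (w x)])) :
  LiYorke_chaotic (wcomp cw bw cf wf_compact) <->
  exists B : nat -> set X,
    (forall i, open (B i) /\ precompact (B i)) /\
    (exists n : nat -> nat,
      (forall j, (0 < n j)%N) /\
      {homo n : i j / (i < j)%N} /\
      forall i,
        supnorm (iter (n j) f @^-1` B i) (wprod w f (n j)) @[j --> \oo]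
          --> 0%E) /\
    ereal_sup [set supnorm (iter n f @^-1` B i) (wprod w f n) |
                 i in [set: nat] & n in [set n : nat | (0 < n)%N]] = +oo%E.
Proof.
rewrite LiYorke_chaotic_semi_irregularP; split=> [[phi]|].
  exact: semi_irregular_weights.
move=> [B [oB [[n [_ [n_homo B_to0]]] B_sup]]].
exact: weights_semi_irregular n_homo B_to0 B_sup.
Qed.
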